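(* Let $f:(0,\infty)\to(0,\infty)$ be a geometrically convex function with $f(1)\leq 1$. Then $f(x)^r\geq f(x^r)$ for all $x>0$ and all $0\leq r\leq 1$.
   Context: A function $f:(0,\infty)\to(0,\infty)$ is called geometrically convex (or multiplicatively convex) if $f(a^{1-v}b^v)\leq f(a)^{1-v}f(b)^v$ for all $a,b>0$ and all $v\in[0,1]$. *)

(* Defs.v *)
From Stdlib Require Import Reals.
Open Scope R_scope.

(** A function (0,oo) -> (0,oo) is represented by a total [f : R -> R] of which
    only the restriction to (0,oo) matters. *)
Definition maps_pos_to_pos (f : R -> R) : Prop :=
  forall x : R, 0 < x -> 0 < f x.

(** Every base below is positive on the domain of interest, where [Rpower] is
    the usual real power. *)
Definition geometrically_convex (f : R -> R) : Prop :=
  forall a b v : R, 0 < a -> 0 < b -> 0 <= v <= 1 ->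
    f (Rpower a (1 - v) * Rpower b v) <=
    Rpower (f a) (1 - v) * Rpower (f b) v.

(* Main.v *)
Require Import Defs.
From Stdlib Require Import Reals Lra.
Open Scope R_scope.

Lemma Rpower_base_1 (y : R) : Rpower 1 y = 1.
Proof. unfold Rpower; rewrite ln_1, Rmult_0_r; apply exp_0. Qed.

Theorem proposition3p1 (f : R -> R)
  (f_pos : maps_pos_to_pos f)
  (f_gconvex : geometrically_convex f)
  (f1_le1 : f 1 <= 1) :
  forall x r : R, 0 < x -> 0 <= r <= 1 -> Rpower (f x) r >= f (Rpower x r).
Proof.
  intros x r x_pos r01.
  pose proof (f_gconvex 1 x r Rlt_0_1 x_pos r01) as f_1x.
  rewrite Rpower_base_1, Rmult_1_l in f_1x.
  assert (f1_pow : Rpower (f 1) (1 - r) <= 1).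
  { apply Rle_trans with (Rpower 1 (1 - r)); [| rewrite Rpower_base_1; lra].
    apply Rle_Rpower_l; [lra | split; [apply f_pos; lra | exact f1_le1]]. }
  assert (fx_pow : 0 < Rpower (f x) r) by apply exp_pos.
  (* The product needed is (1 - f(1)^(1-r)) * f(x)^r >= 0, from [f1_pow] and [fx_pow]; added to
     [f_1x] it gives the claim. *)
  nra.
Qed.
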